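(* Let $\alpha$ and $\beta$ be fixed partitions. Then, as a function of the integer $k$ (for $k$ at least the number of parts of $\alpha$ and of $\beta$), $N_k(\alpha;\beta)$ is a polynomial in $k$ of degree at most $2(|\alpha|+|\beta|)$.
   Context: A partition with at most $k$ parts is identified with the nonincreasing $k$-tuple of nonnegative integers obtained by padding with zeros; $|\alpha|=\sum_i\alpha_i$. $\tilde M_k$: for $k$-tuples $a=(a_1,\dots,a_k)$, $b=(b_1,\dots,b_k)$ of nonnegative integers, $\tilde M_k(a,b)=(-1)^{\sum_i b_i}\det(m_{ij})_{1\le i,j\le 2k}$, where for $1\le i\le k$, $1\le j\le 2k$: $m_{ij}=\Gamma(2k-i-j+2-a_i)^{-1}$ and $m_{k+i,j}=(-1)^{i+j-1}\Gamma(2k-i-j+2-b_i)^{-1}$, with the convention $1/\Gamma(m)=0$ for $m\in\{0,-1,-2,\dots\}$. $N_k$: with $r=|\alpha|+|\beta|$, $$N_k(\alpha;\beta)=\frac{1}{2^{k^2-r}}\Bigl(\prod_{l=0}^{k-1}\frac{l!}{(k+l)!}\Bigr)^{-1}\sum_{\sigma(\alpha),\tau(\beta)}\tilde M_k(\sigma(\alpha),\tau(\beta)),$$ where the sum runs over all distinct rearrangements $\sigma(\alpha)=(\alpha_{\sigma_1},\dots,\alpha_{\sigma_k})$ of the $k$-tuple $\alpha$ and $\tau(\beta)$ of $\beta$ (two rearrangements are the same if they give the same $k$-tuple). *)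

(* Defs.v *)
From HB Require Import structures.
From mathcomp Require Import all_boot all_order all_algebra.
Set Implicit Arguments. Unset Strict Implicit. Unset Printing Implicit Defensive.
Import Order.TTheory GRing.Theory Num.Theory.
Local Open Scope ring_scope.

Definition invGamma (m : int) : rat :=
  match m with
  | Posz n.+1 => (n`!)%:R^-1
  | _ => 0
  end.

Definition is_partition (s : seq nat) : bool :=
  sorted geq s && (0%N \notin s).

Definition psize (s : seq nat) : nat := sumn s.

(* the k-tuple obtained by padding with zeros (assumes size s <= k) *)
Definition pad (k : nat) (s : seq nat) : seq nat := s ++ nseq (k - size s) 0%N.

(* The 2k x 2k matrix (m_ij), written with 1-based indices i, j. *)
Definition Mmat (k : nat) (a b : seq nat) : 'M[rat]_(2 * k) :=
  \matrix_(i0 < 2 * k, j0 < 2 * k)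
    let j := (j0 : nat).+1 in
    if (i0 < k)%N then
      let i := (i0 : nat).+1 in
      invGamma ((2 * k)%:Z - i%:Z - j%:Z + 2 - (nth 0%N a i.-1)%:Z)
    else
      let i := ((i0 : nat) - k).+1 in
      (-1) ^+ (i + j - 1) *
      invGamma ((2 * k)%:Z - i%:Z - j%:Z + 2 - (nth 0%N b i.-1)%:Z).

Definition Mtilde (k : nat) (a b : seq nat) : rat :=
  (-1) ^+ (sumn b) * \det (Mmat k a b).

(* N_k(alpha; beta); the sum ranges over all distinct rearrangements of the
   padded k-tuples ([permutations] is duplicate-free). *)
Definition Nk (k : nat) (alpha beta : seq nat) : rat :=
  let r := (psize alpha + psize beta)%N in
  (2%:R ^ ((k ^ 2)%N%:Z - r%:Z))^-1 *
  (\prod_(l < k) ((l`!)%:R / ((k + l)`!)%:R))^-1 *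
  \sum_(s <- permutations (pad k alpha))
    \sum_(t <- permutations (pad k beta)) Mtilde k s t.

(* Main.v *)
Require Import Defs.
From HB Require Import structures.
From mathcomp Require Import all_boot all_order all_algebra.
From mathcomp Require Import ring zify.
From Stdlib Require Import FunctionalExtensionality.
Set Implicit Arguments. Unset Strict Implicit. Unset Printing Implicit Defensive.
Import Order.TTheory GRing.Theory Num.Theory.
Local Open Scope ring_scope.

(* Reading the columns as powers of x modulo x^(2k), the rows of the matrix are
   x^(i-1+a_i) e^x and x^(i-1+b_i) e^(-x), the sign of Mtilde being absorbed by
   the latter.  Multiplication by x^n (n > 0) is nilpotent on Q[x]/(x^(2k)), so
   its trace vanishes: the power sum p_n acting on the a-rows and p_n acting on
   the b-rows add up to zero on the determinant.  This moves the parts of beta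
   one by one over to alpha and reduces the theorem to beta = 0.  There,
   multiplication by e^x makes the matrix block triangular and the determinant
   becomes a Vandermonde determinant.  With rows numbered from the bottom, the
   normalised value at (a, 0) is
     H(a) prod_s prod_(v < a_s) (k + s - v) (k - s + v),
   with H(a) independent of k, a polynomial in k of degree 2|a|.  It vanishes
   when a_s > 0 for some s >= |a|, and its value at k vanishes when a_s > 0 for
   some s >= k.  So for every k, small or large, the sum over rearrangements is
   the same finite sum of polynomials, over the a supported below |alpha|. *)

(** * Sums over placements of parts *)

Definition incr (a : nat -> nat) (i x s : nat) : nat := (a s + (s == i) * x)%N.

(* Sum of G over all ways to add the parts in s to pairwise distinct zero
   entries of a with index < k.  From a = 0 this is a k-independent multiple of
   the sum over distinct rearrangements (aug_permutations). *)
Fixpoint aug (V : nmodType) (k : nat) (s : seq nat) (G : (nat -> nat) -> V)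
    (a : nat -> nat) : V :=
  if s is x :: s' then
    \sum_(i < k | a i == 0%N) aug k s' G (incr a i x)
  else G a.

(* Multiplying an augmented monomial symmetric function by the power sum p_b
   either adds b as a new part or adds it to an existing one. *)
Fixpoint merges (b : nat) (s : seq nat) : seq (seq nat) :=
  if s is x :: s' then (x + b :: s')%N :: map (cons x) (merges b s') else [::].

Lemma incr_other a i x s : s != i -> incr a i x s = a s.
Proof. by rewrite /incr => /negPf->; rewrite addn0. Qed.

Lemma incr_same a i x : incr a i x i = (a i + x)%N.
Proof. by rewrite /incr eqxx mul1n. Qed.

Lemma incrC a i j x y : incr (incr a i x) j y = incr (incr a j y) i x.
Proof. by apply: functional_extensionality => s; rewrite /incr addnAC. Qed.

Lemma incrD a i x y : incr (incr a i x) i y = incr a i (x + y).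
Proof.
by apply: functional_extensionality => s; rewrite /incr mulnDr addnA.
Qed.

Lemma aug_rcons (V : nmodType) k s x (G : _ -> V) a :
  aug k (rcons s x) G a =
  aug k s (fun c => \sum_(i < k | c i == 0%N) G (incr c i x)) a.
Proof.
by elim: s a => [|y s IH] a //=; apply: eq_bigr => i _; rewrite IH.
Qed.

Lemma aug_sum (V : nmodType) k s (I : Type) (r : seq I) (P : pred I)
    (G : I -> _ -> V) a :
  aug k s (fun c => \sum_(j <- r | P j) G j c) a =
  \sum_(j <- r | P j) aug k s (G j) a.
Proof.
elim: s a => [|y s IH] a //=; rewrite exchange_big /=.
by apply: eq_bigr => i _; rewrite IH.
Qed.

Lemma aug_add (V : nmodType) k s (G G' : _ -> V) a :
  aug k s (fun c => G c + G' c) a = aug k s G a + aug k s G' a.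
Proof.
elim: s a => [|y s IH] a //=; rewrite -big_split /=.
by apply: eq_bigr => i _; rewrite IH.
Qed.

Lemma aug_opp (V : zmodType) k s (G : _ -> V) a :
  aug k s (fun c => - G c) a = - aug k s G a.
Proof.
elim: s a => [|y s IH] a //=; rewrite -sumrN.
by apply: eq_bigr => i _; rewrite IH.
Qed.

Lemma horner_aug (R : nzRingType) k s (G : _ -> {poly R}) a (x : R) :
  (aug k s G a).[x] = aug k s (fun c => (G c).[x]) a.
Proof.
elim: s a => [|y s IH] a //=; rewrite horner_sum.
by apply: eq_bigr => i _; rewrite IH.
Qed.

Lemma size_aug (R : nzRingType) k s (G : _ -> {poly R}) a d :
  (forall c, size (G c) <= d)%N -> (size (aug k s G a) <= d)%N.
Proof.
move=> size_G; elim: s a => [|y s IH] a //=.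
by apply: leq_trans (size_sum _ _ _) _; apply/bigmax_leqP => i _; apply: IH.
Qed.

Lemma aug_scale k s (z : rat) (G : _ -> rat) a :
  aug k s (fun c => z * G c) a = z * aug k s G a.
Proof.
elim: s a => [|y s IH] a //=; rewrite mulr_sumr.
by apply: eq_bigr => i _; rewrite IH.
Qed.

Lemma sum_incr n a (i : 'I_n) x :
  (\sum_(j < n) incr a i x j = \sum_(j < n) a j + x)%N.
Proof.
rewrite (bigD1 i) //= [in RHS](bigD1 i) //= incr_same addnAC; congr (_ + _ + _)%N.
by apply: eq_bigr => j ji; rewrite incr_other.
Qed.

(** Summands need only agree at the tuples actually reached; the bounds and the total granted here
    feed the later support arguments. *)
Lemma eq_aug (V : nmodType) k s (G G' : _ -> V) a :
    (forall c, (forall i, a i <= c i)%N ->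
       (forall i, k <= i -> c i = a i)%N ->
       (\sum_(i < k) c i = \sum_(i < k) a i + sumn s)%N -> G c = G' c) ->
  aug k s G a = aug k s G' a.
Proof.
elim: s a => [|x s IH] a /= eqG.
  by apply: eqG => // ; rewrite addn0.
apply: eq_bigr => i _; apply: IH => c le_c c_out c_sum; apply: eqG.
- by move=> j; apply: leq_trans (le_c j); rewrite /incr leq_addr.
- by move=> j kj; rewrite c_out // incr_other // neq_ltn (leq_trans _ kj) ?orbT.
- by rewrite c_sum sum_incr addnA.
Qed.

(** The index receiving [b] is empty after [s] is placed (a new part), holds a part just placed (a
    merge), or was nonzero in [a] already. The last kind is absent for [a] = 0 but must be tracked
    in the induction. *)
Lemma aug_power_sum (V : nmodType) k s b (G : _ -> V) a : all (ltn 0) s ->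
  aug k s (fun c => \sum_(i < k) G (incr c i b)) a =
  aug k (rcons s b) G a + \sum_(t <- merges b s) aug k t G a
  + \sum_(i < k | a i != 0%N) aug k s G (incr a i b).
Proof.
elim: s a => [|x s IH] a /=.
  by move=> _; rewrite big_nil addr0 (bigID (fun i : 'I_k => a i == 0%N)).
case/andP=> x_gt0 s_gt0; rewrite big_cons big_map /=.
under eq_bigr => i _ do rewrite IH //.
rewrite !big_split /= -!addrA; congr (_ + _).
rewrite exchange_big /= addrCA; congr (_ + _).
rewrite [in RHS](exchange_big_dep (fun i : 'I_k => a i == 0%N)) /=; last first.
  by move=> i j _; rewrite /incr addn_eq0 => /andP[].
rewrite -big_split /=; apply: eq_bigr => i ai0.
(* The index [i] just filled by [x] gives the merge [x + b]; the other nonzero indices were nonzero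
   in [a] already. *)
rewrite (bigD1 i) /=; last by rewrite incr_same (eqP ai0) -lt0n.
rewrite incrD.
congr (_ + _); apply: eq_big => [j|j /andP[_ ji]]; last by rewrite incrC.
have [->|ji] := eqVneq j i; first by rewrite ai0 andbF.
rewrite andbT incr_other //; have [aj0|aj] := eqVneq (a j) 0%N => //=.
by rewrite incr_other ?ai0 // eq_sym.
Qed.

Lemma merges_sumn b s t : t \in merges b s -> sumn t = (sumn s + b)%N.
Proof.
elim: s t => [|x s IH] t //=; rewrite inE => /predU1P[->|/mapP[u us ->]] /=.
  by rewrite addnAC.
by rewrite IH // addnA.
Qed.

Lemma merges_size b s t : t \in merges b s -> size t = size s.
Proof.
by elim: s t => [|x s IH] t //=; rewrite inE => /predU1P[->|/mapP[u /IH<- ->]].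
Qed.

Lemma merges_gt0 b s t : all (ltn 0) s -> t \in merges b s -> all (ltn 0) t.
Proof.
elim: s t => [|x s IH] t //= /andP[x0 s0].
rewrite inE => /predU1P[->|/mapP[u us ->]] /=; first by rewrite s0 ltn_addr.
by rewrite x0 IH.
Qed.

(** * The polynomial attached to a placement, and its vanishing *)

(* Independent of K as soon as a vanishes from K on; up to sign it is the inverse of the
   hook product of the partition with beta-numbers a_s - s, and zero if two of
   these coincide. *)
Definition hookp (K : nat) (a : nat -> nat) : rat :=
  (\prod_(s < K) (((K.-1 - s + a s)`!)%:R^-1)) *
  \prod_(t < K) \prod_(s < t) ((t + a s)%:R - (s + a t)%:R).

Definition Qp (K : nat) (a : nat -> nat) : {poly rat} :=
  hookp K a *: \prod_(s < K) \prod_(v < a s)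
    (('X + (s%:R - v%:R)%:P) * ('X + (v%:R - s%:R)%:P)).

(** Raising [K] multiplies the factorial of row [s] by [K - s + a s], which is exactly the new
    difference factor for the pair [s], [K]. *)
Lemma hookpS K a : a K = 0%N -> hookp K.+1 a = hookp K a.
Proof.
move=> aK; rewrite /hookp !big_ord_recr /= subnn aK !addn0 fact0 invr1 mulr1.
rewrite mulrCA [RHS]mulrC; congr (_ * _); rewrite -big_split /=.
apply: eq_bigr => s _.
have -> : (K - s + a s = (K.-1 - s + a s).+1)%N by have := ltn_ord s; lia.
rewrite factS natrM invfM -natrB; last by have := ltn_ord s; lia.
have -> : (K + a s - (s + 0) = (K.-1 - s + a s).+1)%N by have := ltn_ord s; lia.
by rewrite mulrAC mulVf ?mul1r ?pnatr_eq0.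
Qed.

Lemma QpS K a : a K = 0%N -> Qp K.+1 a = Qp K a.
Proof.
by move=> aK; rewrite /Qp hookpS // big_ord_recr /= aK big_ord0 mulr1.
Qed.

Lemma Qp_widen n K a : (n <= K)%N -> (forall s, n <= s -> s < K -> a s = 0)%N ->
  Qp K a = Qp n a.
Proof.
move=> /subnK<-; elim: (K - n)%N => // d IH a0.
rewrite addSn QpS ?a0 ?leq_addl //; apply: IH => s ns sd; apply: a0 => //.
by rewrite addSn ltnW.
Qed.

(* The position s - a_s must itself be moved, or else it would collide with
   position s. *)
Lemma hookp_chain K a s : hookp K a != 0 -> (s < K)%N -> (0 < a s <= s)%N ->
  (0 < a (s - a s))%N.
Proof.
rewrite mulf_eq0 negb_or => /andP[_ /prodf_neq0 Hne] sK /andP[a0 as_le].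
have /prodf_neq0 := Hne (Ordinal sK) isT.
have lt_s : (s - a s < s)%N by lia.
move/(_ (Ordinal lt_s) isT) => /=; rewrite subnK // natrD addrC addKr.
by rewrite pnatr_eq0 -lt0n.
Qed.

(* Iterating hookp_chain descends from s by steps a_u until below zero, whence
   the steps add up to more than s. *)
Lemma hookp_bound K a s : hookp K a != 0 -> (s < K)%N -> (0 < a s)%N ->
  (s < \sum_(u < s.+1) a u)%N.
Proof.
move=> h0; elim/ltn_ind: s => s IH sK a0; rewrite big_ord_recr /=.
have [lt_s|le_a] := ltnP s (a s); first by rewrite ltn_addl.
have t0 : (0 < a (s - a s))%N by apply: hookp_chain h0 _ _; rewrite ?a0.
have ts : (s - a s < s)%N by lia.
have := IH _ ts (ltn_trans ts sK) t0.
have : (\sum_(u < (s - a s).+1) a u <= \sum_(u < s) a u)%N.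
  rewrite -!(big_mkord predT a) [leqRHS](big_cat_nat _ (n := (s - a s).+1)) //=.
  by rewrite leq_addr.
by move=> h1 h2; have := leq_trans h2 h1; rewrite ltn_subLR // addnC.
Qed.

(** The descent of [hookp_chain] from [s] stays among nonzero rows, so at some row [t] it must step
    from [k] or above to below [k]. *)
Lemma hookp_crossing K a k s : hookp K a != 0 -> (s < K)%N -> (0 < a s)%N ->
  (k <= s)%N -> exists2 t, (k <= t < K)%N & (t - k < a t)%N.
Proof.
move=> h0; elim/ltn_ind: s => s IH sK a0 ks.
have [lt_a|le_a] := ltnP (s - k) (a s); first by exists s; rewrite ?ks.
have as_le : (a s <= s)%N by apply: leq_trans le_a (leq_subr _ _).
apply: (IH (s - a s)%N); [lia | lia | | lia].
by apply: hookp_chain h0 sK _; rewrite a0.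
Qed.

Lemma Qp_eq0 K a s :
  (s < K)%N -> (0 < a s)%N -> (\sum_(u < K) a u <= s)%N -> Qp K a = 0.
Proof.
move=> sK a0 le_s; have [h0|h0] := eqVneq (hookp K a) 0.
  by rewrite /Qp h0 scale0r.
have := hookp_bound h0 sK a0; rewrite ltnNge => /negP[].
apply: leq_trans le_s; rewrite -!(big_mkord predT a).
by rewrite [leqRHS](big_cat_nat _ (n := s.+1)) //= leq_addr.
Qed.

Lemma horner_Qp K a (x : rat) : (Qp K a).[x] = hookp K a *
  \prod_(s < K) \prod_(v < a s) ((x + (s%:R - v%:R)) * (x + (v%:R - s%:R))).
Proof.
rewrite hornerZ horner_prod; congr (_ * _); apply: eq_bigr => s _.
by rewrite horner_prod; apply: eq_bigr => v _; rewrite !hornerE.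
Qed.

Lemma Qp_root K a k s : (s < K)%N -> (0 < a s)%N -> (k <= s)%N ->
  (Qp K a).[k%:R] = 0.
Proof.
move=> sK a0 ks; rewrite horner_Qp; have [->|h0] := eqVneq (hookp K a) 0.
  by rewrite mul0r.
have [t /andP[kt tK] ta] := hookp_crossing h0 sK a0 ks.
(* The factor with [v = t - k] in row [t] is [k + (v - t)], which vanishes. *)
rewrite (bigD1 (Ordinal tK)) //= (bigD1 (Ordinal ta)) //= natrB //.
by rewrite [_ - k%:R - _]addrAC subrr add0r subrr mulr0 !(mul0r, mulr0).
Qed.

Lemma size_Qp K a : (size (Qp K a) <= (2 * \sum_(s < K) a s).+1)%N.
Proof.
apply: leq_trans (size_scale_leq _ _) _.
have XC (z : rat) : size ('X + z%:P)%R = 2 by rewrite size_XaddC.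
pose f s : {poly rat} := \prod_(v < a s)
  (('X + (s%:R - v%:R)%:P) * ('X + (v%:R - s%:R)%:P)).
have Hf s : (size (f s) <= (2 * a s).+1)%N.
  apply: leq_trans (size_poly_prod_leq _ _) _.
  rewrite cardT size_enum_ord leq_subLR.
  have -> : (a s + (2 * a s).+1 = (\sum_(v < a s) 3).+1)%N.
    by rewrite big_const_ord iter_addn; lia.
  rewrite ltnS; apply: leq_sum => v _.
  by apply: leq_trans (size_polyMleq _ _) _; rewrite !XC.
apply: leq_trans (size_poly_prod_leq _ _) _.
rewrite cardT size_enum_ord leq_subLR.
apply: (@leq_trans (\sum_(s < K) (2 * a s).+1).+1).
  by rewrite ltnS; apply: leq_sum => s _; apply: Hf.
rewrite addnS ltnS; under eq_bigr => s _ do rewrite -add1n.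
by rewrite big_split /= sum1_card card_ord big_distrr.
Qed.

(** * Independence of the number of rows *)

Lemma aug_restrict n K s (G : _ -> rat) a : (n <= K)%N -> all (ltn 0) s ->
  (forall c, (exists2 i, n <= i < K & 0 < c i)%N -> G c = 0) ->
  aug K s G a = aug n s G a.
Proof.
move=> nK + G0; elim: s a => [|x s IH] a //= /andP[x0 s0].
rewrite -(big_mkord (fun i => a i == 0%N) (fun i => aug K s G (incr a i x))).
rewrite -(big_mkord (fun i => a i == 0%N) (fun i => aug n s G (incr a i x))).
rewrite (big_cat_nat _ (n := n)) //= [X in _ + X]big_nat_cond [X in _ + X]big1 ?addr0.
  by apply: eq_bigr => i _; rewrite IH.
(* Zero is written as a multiple of an [aug] sum so that [eq_aug] compares termwise. *)
move=> i /andP[iK _]; rewrite -[RHS](mul0r (aug K s (fun=> 0) (incr a i x))).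
rewrite -aug_scale; apply: eq_aug => c le_c _ _; rewrite mul0r; apply: G0.
by exists i => //; apply: leq_trans (le_c i); rewrite incr_same ltn_addl.
Qed.

(** Both sides equal the sum over [maxn k (sumn s)] rows: evaluation at [k] kills entries from row
    [k] on ([Qp_root]), and [Qp_eq0] kills those from the total on. *)
Lemma aug_Qp k s : all (ltn 0) s ->
  aug k s (fun a => (Qp k a).[k%:R]) (fun=> 0%N) =
  aug (sumn s) s (fun a => (Qp (sumn s) a).[k%:R]) (fun=> 0%N).
Proof.
move=> s0; set r := sumn s; pose K := maxn k r.
have zero0 n : (\sum_(i < n) (fun=> 0) i = 0)%N by rewrite big1.
transitivity (aug K s (fun a => (Qp K a).[k%:R]) (fun=> 0%N)).
  have kK : (k <= K)%N by rewrite leq_maxl.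
  rewrite (aug_restrict _ kK) //.
    apply: eq_aug => c _ c_out _; rewrite (Qp_widen (a:=c) kK) //.
    by move=> i ki _; apply: c_out.
  by move=> c [i /andP[ki iK] ci]; apply: Qp_root ci ki.
have rK : (r <= K)%N by rewrite leq_maxr.
(* [aug_restrict] asks for vanishing at every [c], whereas [Qp_eq0] needs the total, so the total is
   built into the summand. *)
transitivity (aug K s (fun a => if (\sum_(i < K) a i)%N == r
                                then (Qp K a).[k%:R] else 0) (fun=> 0%N)).
  by apply: eq_aug => c _ _ ->; rewrite zero0 eqxx.
rewrite (aug_restrict _ rK) //.
  apply: eq_aug => c _ c_out; rewrite zero0 => c_sum.
  rewrite (Qp_widen (a:=c) rK) => [|i ri _]; last exact: c_out.
  rewrite -(subnK rK) addnC big_split_ord /= c_sum big1 ?addn0 ?eqxx //.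
  by move=> i _; apply: c_out; rewrite leq_addr.
move=> c [i /andP[ki iK] ci]; case: eqP => // c_sum.
by rewrite (Qp_eq0 (a:=c) iK) ?horner0 // c_sum.
Qed.

Lemma aug_Qp_poly s : all (ltn 0) s ->
  exists2 P : {poly rat}, (size P <= (2 * sumn s).+1)%N &
    forall k, aug k s (fun a => (Qp k a).[k%:R]) (fun=> 0%N) = P.[k%:R].
Proof.
move=> s0; set r := sumn s.
pose G (a : nat -> nat) := if (\sum_(i < r) a i)%N == r then Qp r a else 0.
exists (aug r s G (fun=> 0%N)).
  apply: size_aug => a; rewrite /G; case: eqP => [sum_a|_].
    by rewrite -[X in (2 * X)%N]sum_a size_Qp.
  by rewrite size_poly0.
move=> k; rewrite horner_aug aug_Qp //; apply: eq_aug => a _ _.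
by move=> sum_a; rewrite /G sum_a [X in (X + _)%N]big1 // eqxx.
Qed.

(** * Determinant identities *)

Lemma det_scale_rows (R : comNzRingType) n (d : 'I_n -> R) (A : 'M[R]_n) :
  \det (\matrix_(i, j) (d i * A i j)) = (\prod_i d i) * \det A.
Proof.
have -> : \matrix_(i, j) (d i * A i j) = diag_mx (\row_i d i) *m A.
  by apply/matrixP=> i j; rewrite mul_diag_mx !mxE.
by rewrite det_mulmx det_diag; congr (_ * _); apply: eq_bigr => i _; rewrite mxE.
Qed.

Lemma det_scale_cols (R : comNzRingType) n (d : 'I_n -> R) (A : 'M[R]_n) :
  \det (\matrix_(i, j) (A i j * d j)) = (\prod_i d i) * \det A.
Proof.
rewrite -det_tr -[in RHS]det_tr -det_scale_rows; congr (\det _).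
by apply/matrixP=> i j; rewrite !mxE mulrC.
Qed.

(** This is the derivative of det(A(1 + tB)) at t = 0. Expanding along the replaced row gives the
    diagonal entries of [A *m B *m \adj A], whose trace is computed cyclically. *)
Lemma sum_det_mul_row (R : comNzRingType) n (A B : 'M[R]_n) :
  \sum_i \det (\matrix_(p, q) (if p == i then (A *m B) p q else A p q)) =
  \tr B * \det A.
Proof.
under eq_bigr => i _.
  rewrite (expand_det_row _ i).
  under eq_bigr => j _.
    have -> : cofactor (\matrix_(p, q) (if p == i then (A *m B) p q else A p q))
        i j = cofactor A i j.
      rewrite /cofactor; congr (_ * \det _); apply/matrixP=> p q.
      by rewrite !mxE eq_sym (negPf (neq_lift _ _)).
    rewrite mxE eqxx [cofactor _ _ _](_ : _ = (\adj A) j i); last by rewrite mxE.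
    over.
  rewrite (_ : \sum_j _ = (A *m B *m \adj A) i i); last by rewrite [RHS]mxE.
  over.
by rewrite -/(mxtrace _) mxtrace_mulC mulmxA mul_adj_mx mul_scalar_mx mxtraceZ mulrC.
Qed.

Lemma big_ord_triangle (R : Type) (idx : R) (op : Monoid.com_law idx) n
    (F : nat -> nat -> R) :
  \big[op/idx]_(i < n) \big[op/idx]_(j < n | (i < j)%N) F i j =
  \big[op/idx]_(j < n) \big[op/idx]_(i < j) F i j.
Proof.
rewrite (exchange_big_dep predT) //=; apply: eq_bigr => j _.
by rewrite (big_ord_widen n (fun i => F i j)) // ltnW.
Qed.

(** A Vandermonde matrix times a coefficient matrix that is triangular with unit diagonal. *)
Lemma det_horner_monic (R : comNzRingType) n (p : nat -> {poly R}) (y : nat -> R) :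
    (forall j, size (p j) = j.+1) -> (forall j, p j \is monic) ->
  \det (\matrix_(i < n, j < n) (p j).[y i]) =
  \prod_(j < n) \prod_(i < j) (y j - y i).
Proof.
move=> size_p monic_p; pose C := \matrix_(j < n, m < n) (p j)`_m.
have -> : \matrix_(i < n, j < n) (p j).[y i] =
    (Vandermonde n (\row_(i < n) y i))^T *m C^T.
  apply/matrixP=> i j; rewrite !mxE (@horner_coef_wide _ n) ?size_p //.
  by apply: eq_bigr => m _; rewrite !mxE mulrC.
have C_trig : is_trig_mx C.
  by apply/is_trig_mxP => i j ij; rewrite mxE nth_default ?size_p.
rewrite det_mulmx !det_tr det_Vandermonde (det_trig C_trig).
rewrite [X in _ * X]big1 ?mulr1 => [|i _]; last first.
  by rewrite mxE; have /eqP := monic_p i; rewrite /lead_coef size_p.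
rewrite -(big_ord_triangle _ n (fun i j => y j - y i)).
by apply: eq_bigr => i _; apply: eq_bigr => j _; rewrite !mxE.
Qed.

Definition ff (j : nat) : {poly rat} := \prod_(v <- iota 0 j) ('X - v%:R%:P).

Lemma natr_ffact n m : (n ^_ m)%:R = \prod_(v < m) (n%:R - v%:R) :> rat.
Proof.
elim: m => [|m IH]; first by rewrite ffactn0 big_ord0.
rewrite big_ord_recr /= -IH ffactnSr natrM.
have [mn|nm] := leqP m n; first by rewrite natrB.
by rewrite ffact_small // !mul0r.
Qed.

Lemma horner_ff j n : (ff j).[n%:R] = (n ^_ j)%:R.
Proof.
rewrite natr_ffact /ff horner_prod.
rewrite -(big_mkord predT (fun v => n%:R - v%:R : rat)) /index_iota subn0.
by apply: eq_bigr => v _; rewrite !hornerE.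
Qed.

Lemma det_ffact n (y : nat -> nat) :
  \det (\matrix_(i < n, j < n) ((y i ^_ j)%:R : rat)) =
  \prod_(j < n) \prod_(i < j) ((y j)%:R - (y i)%:R).
Proof.
rewrite -(det_horner_monic n (p := ff) (fun i => (y i)%:R)).
- by congr (\det _); apply/matrixP=> i j; rewrite !mxE horner_ff.
- by move=> j; rewrite size_prod_XsubC size_iota.
- by move=> j; rewrite monic_prod_XsubC.
Qed.

(** * Rows as coefficients of x^m e^x and x^m e^(-x) *)

(* The coefficient of x^n in x^m e^x. *)
Definition ifact (n m : nat) : rat :=
  if (m <= n)%N then ((n - m)`!)%:R^-1 else 0.

Lemma ifact_small n m : (n < m)%N -> ifact n m = 0.
Proof. by move=> lt_nm; rewrite /ifact leqNgt lt_nm. Qed.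

Lemma invGammaE n m (z : int) : z = n%:Z + 1 - m%:Z -> invGamma z = ifact n m.
Proof.
move=> ->; rewrite /ifact; case: leqP => [le_mn|lt_nm].
  by rewrite (_ : n%:Z + 1 - m%:Z = (n - m)%N.+1%:Z) //; lia.
case Ez: (n%:Z + 1 - m%:Z) => [[|p]|p] //=; lia.
Qed.

(** The coefficient of x^N in the product of x^c e^(yx) and x^j e^x, by the binomial theorem. *)
Lemma ifact_conv (y : rat) N c j :
  \sum_(n < N.+1) y ^+ (n - c) * ifact n c * ifact (N - n) j =
  (1 + y) ^+ (N - (c + j)) * ifact N (c + j).
Proof.
have [lt_N|le_N] := ltnP N (c + j).
  rewrite (ifact_small lt_N) mulr0 big1 // => n _.
  have [nc|cn] := ltnP n c; first by rewrite (ifact_small nc) mulr0 mul0r.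
  by rewrite (@ifact_small (N - n) j) ?mulr0 //; have := ltn_ord n; lia.
pose M := (N - (c + j))%N.
rewrite -(big_mkord predT (fun n => y ^+ (n - c) * ifact n c * ifact (N - n) j)).
rewrite (@big_cat_nat _ _ _ c) //=; last by lia.
rewrite big_nat_cond big1 ?add0r; last first.
  by move=> n /andP[/andP[_ nc] _]; rewrite (ifact_small nc) mulr0 mul0r.
rewrite (@big_cat_nat _ _ _ (c + M.+1)) //=; [|lia|lia].
rewrite [X in _ + X]big_nat_cond [X in _ + X]big1 ?addr0; last first.
  move=> n /andP[/andP[n1 n2] _]; rewrite (@ifact_small (N - n) j) ?mulr0 //; lia.
rewrite -[c in index_iota c _]add0n big_addn addKn big_mkord -/M /ifact le_N -/M exprDn.
rewrite mulr_suml; apply: eq_bigr => m _; have := ltn_ord m => ltm.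
rewrite addnK leq_addl expr1n mul1r.
have -> : (j <= N - (m + c))%N by lia.
have -> : (N - (m + c) - j = M - m)%N by lia.
rewrite -[_ *+ 'C(M, m)]mulr_natr -!mulrA; congr (_ * _).
have nzf p : (p`!)%:R != 0 :> rat by rewrite pnatr_eq0 -lt0n fact_gt0.
have le_mM : (m <= M)%N by rewrite -ltnS.
rewrite -(bin_fact le_mM).
rewrite !natrM; have nzb : ('C(M, m))%:R != 0 :> rat.
  by rewrite pnatr_eq0 -lt0n bin_gt0.
by field; rewrite nzb !nzf.
Qed.

(* Entries with the sign of Mtilde moved into the lower rows; [a] and [b] are
   functions of the 0-based row. *)
Definition zent (k : nat) (a b : nat -> nat) (i j : nat) : rat :=
  let n := ((k + k).-1 - j)%N in
  if (i < k)%N then ifact n (i + a i)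
  else (-1) ^+ (n + (i - k + b (i - k)))%N * ifact n (i - k + b (i - k)%N).

Definition Mdet (k : nat) (a b : nat -> nat) : rat :=
  \det (\matrix_(i < k + k, j < k + k) zent k a b i j).

Lemma Mtilde_Mdet k s t : size t = k ->
  Mtilde k s t = Mdet k (nth 0%N s) (nth 0%N t).
Proof.
move=> size_t; rewrite /Mtilde /Mmat /Mdet.
have kk : (2 * k = k + k)%N by rewrite mul2n addnn.
move: (2 * k)%N kk => n ->.
pose d (i : 'I_(k + k)) : rat :=
  if (i < k)%N then 1 else (-1) ^+ nth 0%N t (i - k).
have -> : (-1) ^+ sumn t = \prod_i d i.
  rewrite big_split_ord /= big1 ?mul1r => [|i _]; last by rewrite /d /= ltn_ord.
  rewrite -[in LHS](mkseq_nth 0%N t) size_t sumnE big_map -/(index_iota 0 k).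
  rewrite -[k in iota 0 k]subn0 -/(index_iota 0 k) big_mkord.
  rewrite (big_morph _ (exprD (-1)) (expr0 (-1))); apply: eq_bigr => i _.
  by rewrite /d /= ltnNge leq_addr /= addKn.
rewrite -det_scale_rows; congr (\det _); apply/matrixP=> i j; rewrite !mxE /d /zent.
have ltj := ltn_ord j.
case: ifP => [lt_ik|/negbT]; [rewrite mul1r|rewrite -leqNgt => le_ki].
  by apply: invGammaE => /=; lia.
rewrite mulrA; congr (_ * _); last by apply: invGammaE => /=; lia.
(* The signs agree: for the 0-based column [j], the numbers [j + 1] and [2k - 1 - j] have the even
   sum [2k]. *)
rewrite -exprD -[LHS]signr_odd -[RHS]signr_odd; congr (_ ^+ _); congr (nat_of_bool _).
lia.
Qed.

(* Adding n to the exponent of a row multiplies it by the strictly triangular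
   matrix B, whose trace is 0. *)
Lemma Mdet_power_sum k a b n : (0 < n)%N ->
  \sum_(i < k) Mdet k (incr a i n) b + \sum_(i < k) Mdet k a (incr b i n) = 0.
Proof.
move=> n0; pose A := \matrix_(i < k + k, j < k + k) zent k a b i j.
pose B : 'M[rat]_(k + k) := \matrix_(p, q) ((p : nat) == (q + n)%N)%:R.
have := sum_det_mul_row A B.
have -> : \tr B = 0.
  rewrite /mxtrace big1 // => i _; rewrite mxE -{1}[i : nat]addn0 eqn_add2l.
  by rewrite eq_sym gtn_eqF.
rewrite mul0r big_split_ord /= => sum0; apply: etrans sum0.
have AB p q : (A *m B) p q =
    if (q + n < k + k)%N then zent k a b p (q + n) else 0.
  rewrite mxE; case: ifP => qn.
    rewrite (bigD1 (Ordinal qn)) //= !mxE /= eqxx mulr1 big1 ?addr0 // => j jq.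
    by rewrite !mxE -val_eqE /= in jq *; rewrite (negPf jq) mulr0.
  rewrite big1 // => j _; rewrite !mxE; case: eqP => [jE|]; last by rewrite mulr0.
  by rewrite -jE ltn_ord in qn.
congr (_ + _); apply: eq_bigr => i _; congr (\det _); apply/matrixP=> p q.
  rewrite [LHS]mxE [RHS]mxE AB mxE -val_eqE /=; have ltq := ltn_ord q.
  rewrite /zent /=; case: (eqVneq (p : nat) i) => [->|pi]; last first.
    by rewrite incr_other.
  rewrite ltn_ord incr_same; case: ifP => qn; last by rewrite ifact_small //; lia.
  by rewrite /ifact; do 2![case: leqP => ? //]; try lia; congr (_`!%:R^-1); lia.
rewrite [LHS]mxE [RHS]mxE AB mxE -val_eqE /=; have ltq := ltn_ord q.
rewrite /zent /=; case: (eqVneq (p : nat) (k + i)%N) => [->|pi]; last first.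
  by case: ifP => // /negbT; rewrite -leqNgt => kp; rewrite incr_other //; lia.
rewrite ltnNge leq_addr /= addKn incr_same.
case: ifP => qn; last by rewrite ifact_small ?mulr0 //; lia.
have [le1|lt1] := leqP (i + b i) ((k + k).-1 - (q + n)); last first.
  by rewrite !ifact_small ?mulr0 //; lia.
rewrite /ifact le1; have -> : (i + (b i + n) <= (k + k).-1 - q)%N by lia.
congr (_ * _`!%:R^-1); last by lia.
(* Coefficient index and row exponent both grow by [n], so the sign is unchanged. *)
by rewrite -[LHS]signr_odd -[RHS]signr_odd; congr (_ ^+ _); congr (nat_of_bool _); lia.
Qed.

(** * The determinant for beta = 0 *)

Definition rowrev (k : nat) (a : nat -> nat) (i : nat) : nat := a (k - i.+1)%N.

(** [ifact_conv] with [y = 1] in the upper rows and [y = -1] in the lower ones, where e^x cancels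
    e^(-x) and the base becomes 0. *)
Lemma sum_zent_ifact k a i j : (0 < k)%N ->
  let c := if (i < k)%N then (i + a i)%N else (i - k)%N in
  let N := (k + k).-1 in
  \sum_(m < k + k) zent k a (fun=> 0%N) i m * ifact m j =
  (if (i < k)%N then 2 else 0) ^+ (N - (c + j)) * ifact N (c + j).
Proof.
move=> k0 c N; have kkN : (k + k = N.+1)%N by rewrite prednK ?addn_gt0 ?k0.
rewrite -(big_mkord predT (fun m => zent k a (fun=> 0%N) i m * ifact m j)) kkN.
rewrite big_mkord (reindex_inj rev_ord_inj) /=.
pose y : rat := if (i < k)%N then 1 else -1.
have -> : (if (i < k)%N then 2 else 0 : rat) = 1 + y.
  by rewrite /y; case: ifP => _; rewrite ?subrr.
rewrite -ifact_conv; apply: eq_bigr => n _; have := ltn_ord n => ltn.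
rewrite subSS; congr (_ * _); rewrite /zent -/N subKn /y /c; last by rewrite -ltnS.
case: ifP => _; first by rewrite expr1n mul1r.
rewrite addn0; have [lt_n|le_n] := leqP (i - k) n; last first.
  by rewrite ifact_small ?mulr0.
congr (_ * _); rewrite -[LHS]signr_odd -[RHS]signr_odd.
by congr (_ ^+ _); congr (nat_of_bool _); lia.
Qed.

(* Multiplying by e^x turns the rows into x^c e^(2x) and x^i; the latter only
   meet the last k columns, in an antidiagonal block. *)
Lemma Mdet0_reduce (k : nat) (a : nat -> nat) :
  Mdet k (rowrev k a) (fun=> 0%N) =
  \det (\matrix_(s < k, j < k)
    ((2 : rat) ^+ (k + s - (a s + j)) * ifact (k + s) (a s + j))).
Proof.
pose Z := \matrix_(i < k + k, j < k + k) zent k (rowrev k a) (fun=> 0%N) i j.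
pose E : 'M[rat]_(k + k) := \matrix_(i, j) ifact i j.
pose J : 'M[rat]_k := \matrix_(i, j) (j == rev_ord i)%:R.
have detE : \det E = 1.
  rewrite det_trig; first by rewrite big1 // => i _; rewrite mxE /ifact leqnn subnn.
  by apply/is_trig_mxP => i j ij; rewrite mxE ifact_small.
have k0 (i : 'I_k) : (0 < k)%N by apply: leq_trans (ltn_ord i).
have -> : Mdet k (rowrev k a) (fun=> 0%N) = \det (Z *m E).
  by rewrite det_mulmx detE mulr1.
have Zdl : dlsubmx (Z *m E) = 0.
  apply/matrixP=> i j; rewrite !mxE; under eq_bigr do rewrite !mxE.
  rewrite sum_zent_ifact ?k0 //= ltnNge leq_addr /= addKn expr0n.
  have := ltn_ord i; have := ltn_ord j => ltj lti.
  by rewrite (_ : (_ == 0)%N = false) ?mul0r //; apply/eqP; lia.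
have Zdr : drsubmx (Z *m E) = J.
  apply/matrixP=> i j; rewrite !mxE; under eq_bigr do rewrite !mxE.
  rewrite sum_zent_ifact ?k0 //= ltnNge leq_addr /= addKn expr0n.
  rewrite -val_eqE /= /ifact; have := ltn_ord i; have := ltn_ord j => ltj lti.
  case: ((j : nat) =P (k - i.+1)%N) => [jE|j_ne].
    have -> : (i + (k + j) = (k + k).-1)%N by lia.
    by rewrite leqnn subnn mul1r.
  (* Past [(k + k).-1] the truncated exponent is 0 too, but there [ifact] vanishes. *)
  case: leqP => h; last by rewrite mulr0.
  by rewrite (_ : (_ == 0)%N = false) ?mul0r //; apply/eqP; lia.
(* The determinant of [J] is never evaluated: multiplying the upper left block by [J] reverses its
   rows, undoing [rowrev]. *)
rewrite -[Z *m E]submxK Zdl Zdr det_ublock mulrC -det_mulmx; congr (\det _).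
apply/matrixP=> s j; rewrite mxE [RHS]mxE (bigD1 (rev_ord s)) //=.
rewrite [X in _ + X]big1 ?addr0; last first.
  by move=> i /negPf i_ne; rewrite mxE i_ne mul0r.
rewrite mxE eqxx mul1r !mxE.
under eq_bigr do rewrite !mxE; rewrite sum_zent_ifact ?k0 //=.
have lts := ltn_ord s.
rewrite (_ : (k - s.+1 < k)%N = true); last by lia.
rewrite /rowrev (_ : (k - (k - s.+1).+1 = s)%N); last by lia.
rewrite (_ : ((k + k).-1 - (k - s.+1 + a s + j) = k + s - (a s + j))%N); last by lia.
congr (_ * _); rewrite /ifact.
rewrite (_ : ((k + k).-1 - (k - s.+1 + a s + j) = k + s - (a s + j))%N); last by lia.
by rewrite (_ : (k - s.+1 + a s + j <= (k + k).-1)%N = (a s + j <= k + s)%N) //; lia.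
Qed.

Lemma natf_neq0 n : (n`!)%:R != 0 :> rat.
Proof. by rewrite pnatr_eq0 -lt0n fact_gt0. Qed.

(** Splits an entry into a row factor, a column factor and a falling factorial in [n - a], the form
    handled by [det_ffact]. *)
Lemma ifact_ffact n a j :
  (2 : rat) ^+ (n - (a + j)) * ifact n (a + j) =
  (2 ^+ (n - a) * ((n ^_ a)%:R / (n`!)%:R)) * ((n - a) ^_ j)%:R * 2^-1 ^+ j.
Proof.
have [na|an] := ltnP n a.
  by rewrite ffact_small // ifact_small ?mulr0 ?mul0r ?mulr0 ?mul0r //; lia.
rewrite -(ffact_fact an) subnDA; have [lt_j|le_j] := ltnP (n - a) j.
  by rewrite [(n - a) ^_ j]ffact_small // ifact_small ?mulr0 ?mul0r //; lia.
have aj : (a + j <= n)%N by lia.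
rewrite /ifact aj -(ffact_fact le_j) subnDA !natrM.
have := natf_neq0 (n - a - j).
have : (n ^_ a)%:R != 0 :> rat by rewrite pnatr_eq0 -lt0n ffact_gt0.
have : ((n - a) ^_ j)%:R != 0 :> rat by rewrite pnatr_eq0 -lt0n ffact_gt0.
have -> : 2 ^+ (n - a) = 2 ^+ (n - a - j) * 2 ^+ j :> rat.
  by rewrite -exprD subnK.
have : (2 ^+ j : rat) != 0 by rewrite expf_neq0.
rewrite exprVn; move: (2 ^+ j) (2 ^+ (n - a - j)) => z w h1 h2 h3 h4.
by field; rewrite h1 h2 h3 h4.
Qed.

Lemma Mdet0 (k : nat) (a : nat -> nat) :
  Mdet k (rowrev k a) (fun=> 0%N) =
  2 ^ ((k ^ 2)%N%:Z - (\sum_(s < k) a s)%N%:Z) *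
  \prod_(s < k) (((k + s) ^_ (a s))%:R / ((k + s)`!)%:R) *
  \prod_(t < k) \prod_(s < t) ((t + a s)%:R - (s + a t)%:R).
Proof.
rewrite Mdet0_reduce.
under eq_mx do rewrite ifact_ffact.
pose y s := (k + s - a s)%N.
pose g (s : 'I_k) : rat := 2 ^+ y s * (((k + s) ^_ (a s))%:R / ((k + s)`!)%:R).
transitivity (\prod_s g s * (\prod_(j < k) 2^-1 ^+ j *
    \det (\matrix_(s < k, j < k) ((y s ^_ j)%:R : rat)))).
  rewrite -det_scale_cols -det_scale_rows; congr (\det _).
  by apply/matrixP=> s j; rewrite !mxE -mulrA.
rewrite (det_ffact k y).
(* If some [a s] exceeds [k + s], both sides contain a zero falling factorial; otherwise the
   subtraction in [y] is not truncated. *)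
have [/existsP[s lt_s]|/existsPn le_a] := boolP [exists s : 'I_k, (k + s < a s)%N].
  rewrite (bigD1 s) //= [X in _ * X * _](bigD1 s) //= /g ffact_small //.
  by rewrite !(mul0r, mulr0).
have {}le_a (s : 'I_k) : (a s <= k + s)%N by rewrite leqNgt le_a.
rewrite mulrA; congr (_ * _); last first.
  apply: eq_bigr => t _; apply: eq_bigr => s _.
  have le_s := le_a (widen_ord (ltnW (ltn_ord t)) s).
  rewrite /y !natrB ?le_a //= !natrD; ring.
rewrite big_split /= mulrAC; congr (_ * _).
(* Exponents of 2: the sum of [k + s - a s] minus the sum of the column indices is [k ^ 2] minus the
   total of [a]. *)
rewrite -(big_morph _ (exprD 2) (expr0 2)) -(big_morph _ (exprD 2^-1) (expr0 2^-1)).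
rewrite expfzDr // -invr_expz exprVn -!exprnP.
apply: (canRL (mulfK _)); first by rewrite expf_neq0.
rewrite mulrAC; apply: (canLR (mulfK _)); first by rewrite expf_neq0.
rewrite -!exprD -big_split /=; congr (_ ^+ _).
rewrite (eq_bigr (fun s : 'I_k => k + s)%N) => [|s _]; last by rewrite subnK.
by rewrite big_split /= sum_nat_const card_ord.
Qed.

Lemma prodf_rev (R : comNzRingType) k (F : nat -> R) :
  \prod_(s < k) F (k.-1 - s)%N = \prod_(s < k) F s.
Proof.
rewrite [RHS](reindex_inj rev_ord_inj) /=; apply: eq_bigr => s _.
by congr F; have := ltn_ord s; lia.
Qed.

Definition norm (k : nat) (r : nat) : rat :=
  (2%:R ^ ((k ^ 2)%N%:Z - r%:Z))^-1 *
  (\prod_(l < k) ((l`!)%:R / ((k + l)`!)%:R))^-1.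

Lemma norm_Mdet (k : nat) (a : nat -> nat) :
  norm k (\sum_(s < k) a s)%N * Mdet k (rowrev k a) (fun=> 0%N) =
  (Qp k a).[k%:R].
Proof.
rewrite horner_Qp Mdet0 /norm /hookp; set z := 2 ^ _.
have z0 : z != 0 by rewrite expfz_neq0.
set V := \prod_(t < k) \prod_(s < t) _.
rewrite mulrACA mulKf // mulrA [in RHS]mulrAC; congr (_ * _).
rewrite -prodfV -!big_split /=.
transitivity (\prod_(s < k) (((k + s) ^_ (a s))%:R / (s`!)%:R : rat)).
  apply: eq_bigr => s _; field.
  by rewrite !natf_neq0.
(* Reversing [s!] into [(k.-1 - s)!] pairs it with the factorial in [hookp]; their quotient is the
   falling factorial formed by the factors [k - s + v]. *)
rewrite big_split /= -(prodf_rev k (fun s => ((s`!)%:R)^-1)) -big_split /=.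
apply: eq_bigr => s _; have lts := ltn_ord s.
have -> : \prod_(v < a s) ((k%:R + (s%:R - v%:R)) * (k%:R + (v%:R - s%:R))) =
   ((k + s) ^_ (a s))%:R * ((k.-1 - s + a s) ^_ (a s))%:R :> rat.
  rewrite big_split /= !natr_ffact; congr (_ * _).
    by apply: eq_bigr => v _; rewrite natrD addrA.
  rewrite (reindex_inj rev_ord_inj) /=; apply: eq_bigr => v _.
  have ltv := ltn_ord v.
  have -> : k%:R = (k.-1 - s)%:R + s%:R + 1 :> rat.
    by rewrite -natrD natr1; congr _%:R; lia.
  by rewrite [(a s - v.+1)%:R]natrB // -[v.+1%:R]natr1 natrD; ring.
rewrite -[(k.-1 - s + a s)`!](@ffact_fact _ (a s)) ?leq_addl // addnK natrM.
have : ((k.-1 - s + a s) ^_ (a s))%:R != 0 :> rat.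
  by rewrite pnatr_eq0 -lt0n ffact_gt0 leq_addl.
have := natf_neq0 (k.-1 - s) => h1 h2; field.
by rewrite h1 h2.
Qed.

Lemma eq_Mdet k a a' b b' :
    (forall i, i < k -> a i = a' i)%N -> (forall i, i < k -> b i = b' i)%N ->
  Mdet k a b = Mdet k a' b'.
Proof.
move=> eq_a eq_b; congr (\det _); apply/matrixP=> i j; rewrite !mxE /zent.
case: ltnP => [lt_ik|le_ki]; first by rewrite eq_a.
by rewrite eq_b //; have := ltn_ord i; lia.
Qed.

Lemma rowrev_incr k a i n j : (i < k)%N -> (j < k)%N ->
  rowrev k (incr a i n) j = incr (rowrev k a) (k - i.+1) n j.
Proof.
move=> ik jk; rewrite /rowrev /incr; congr (_ + nat_of_bool _ * _)%N.
by apply/eqP/eqP; lia.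
Qed.

(** * Transfer of parts from beta to alpha *)

Definition revdet k a b := Mdet k (rowrev k a) (rowrev k b).

Lemma revdet_power_sum k a b n : (0 < n)%N ->
  \sum_(i < k) revdet k a (incr b i n) = - \sum_(i < k) revdet k (incr a i n) b.
Proof.
move=> /(Mdet_power_sum k (rowrev k a) (rowrev k b)) sum0.
apply/eqP; rewrite -addr_eq0 addrC; apply/eqP; rewrite -[RHS]sum0.
congr (_ + _); rewrite [RHS](reindex_inj rev_ord_inj) /=; apply: eq_bigr => i _.
  by apply: eq_Mdet => // j jk; rewrite rowrev_incr.
by apply: eq_Mdet => // j jk; rewrite rowrev_incr.
Qed.

Definition augdet k s t :=
  aug k s (fun a => aug k t (fun b => revdet k a b) (fun=> 0%N)) (fun=> 0%N).

(** [aug_power_sum] on [t] isolates the term where [n] is a new part; [revdet_power_sum] turns the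
    power sum on the b-rows into minus the one on the a-rows, which is expanded in turn. *)
Lemma augdet_rcons k s t n : (0 < n)%N -> all (ltn 0) s -> all (ltn 0) t ->
  augdet k s (rcons t n) =
  - augdet k (rcons s n) t - \sum_(u <- merges n s) augdet k u t
  - \sum_(u <- merges n t) augdet k s u.
Proof.
move=> n0 s0 t0; pose z : nat -> nat := fun=> 0%N.
have power0 (V : nmodType) u (G : _ -> V) : all (ltn 0) u ->
    aug k u (fun c => \sum_(i < k) G (incr c i n)) z =
    aug k (rcons u n) G z + \sum_(v <- merges n u) aug k v G z.
  by move=> u0; rewrite aug_power_sum // [X in _ + X]big_pred0 ?addr0.
have L : augdet k s (rcons t n) + \sum_(u <- merges n t) augdet k s u =
    aug k s (fun a => aug k t (fun b => \sum_(i < k) revdet k a (incr b i n)) z) z.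
  rewrite -(aug_sum k s (merges n t) predT) -aug_add.
  by apply: eq_aug => a _ _ _; rewrite power0.
apply: (canRL (addrK _)); rewrite L -opprD.
rewrite -(power0 _ s (fun a => aug k t (fun b => revdet k a b) z)) // -aug_opp.
apply: eq_aug => a _ _ _; rewrite -aug_sum -aug_opp; apply: eq_aug => b _ _ _.
exact: revdet_power_sum.
Qed.

Definition poly_fun (d : nat) (F : nat -> rat) : Prop :=
  exists2 P : {poly rat}, (size P <= d.+1)%N & forall k, F k = P.[k%:R].

Lemma poly_funB d F G :
  poly_fun d F -> poly_fun d G -> poly_fun d (fun k => F k - G k).
Proof.
move=> [P sP FP] [Q sQ GQ]; exists (P - Q) => [|k]; last by rewrite !hornerE FP GQ.
by apply: leq_trans (size_polyD _ _) _; rewrite size_polyN geq_max sP.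
Qed.

Lemma poly_funN d F : poly_fun d F -> poly_fun d (fun k => - F k).
Proof.
by move=> [P sP FP]; exists (- P) => [|k]; rewrite ?size_polyN // hornerN FP.
Qed.

Lemma poly_fun_sum d (I : eqType) (r : seq I) (F : I -> nat -> rat) :
  (forall i, i \in r -> poly_fun d (F i)) ->
  poly_fun d (fun k => \sum_(i <- r) F i k).
Proof.
elim: r => [|i r IH] F_poly.
  by exists 0 => [|k]; rewrite ?size_poly0 // big_nil horner0.
have [P sP FP] := F_poly i (mem_head _ _).
have [j jr|Q sQ GQ] := IH; first by apply: F_poly; rewrite inE jr orbT.
exists (P + Q) => [|k]; last by rewrite big_cons FP GQ hornerD.
by apply: leq_trans (size_polyD _ _) _; rewrite geq_max sP.
Qed.

(** Induction on the number of parts of [t]: every term on the right of [augdet_rcons] has one part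
    fewer in its second list and the same total size, hence the same normalisation and degree
    bound. *)
Lemma poly_fun_augdet s t : all (ltn 0) s -> all (ltn 0) t ->
  poly_fun (2 * (sumn s + sumn t))
    (fun k => norm k (sumn s + sumn t) * augdet k s t).
Proof.
have [m] := ubnP (size t); elim: m s t => // m IH s t.
case/lastP: t => [_ s0 _|t n].
  have [P sP augP] := aug_Qp_poly s0.
  exists P => [|k]; rewrite addn0 // -augP /augdet /= -aug_scale.
  apply: eq_aug => a _ _; rewrite [X in (X + _)%N]big1 // add0n => sum_a.
  by rewrite -sum_a -norm_Mdet.
rewrite size_rcons ltnS all_rcons sumn_rcons => le_t s0 /andP[n0 t0].
have [||P sP FP] := IH (rcons s n) t le_t; rewrite ?all_rcons ?s0 ?n0 //.
rewrite sumn_rcons in sP FP.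
have eq_r : (sumn s + n + sumn t = sumn s + (sumn t + n))%N by lia.
rewrite eq_r in sP FP.
have poly1 u : u \in merges n s -> poly_fun (2 * (sumn s + (sumn t + n)))
    (fun k => norm k (sumn s + (sumn t + n)) * augdet k u t).
  move=> us; have := IH u t le_t (merges_gt0 s0 us) t0.
  by rewrite (merges_sumn us) eq_r.
have poly2 u : u \in merges n t -> poly_fun (2 * (sumn s + (sumn t + n)))
    (fun k => norm k (sumn s + (sumn t + n)) * augdet k s u).
  move=> ut; have := IH s u _ s0 (merges_gt0 t0 ut).
  by rewrite (merges_sumn ut) (merges_size ut) => /(_ le_t).
have [Q sQ FQ] := poly_funB (poly_funB (poly_funN (ex_intro2 _ _ P sP FP))
  (poly_fun_sum poly1)) (poly_fun_sum poly2).
by exists Q => // k; rewrite -FQ augdet_rcons // !mulrBr mulrN !mulr_sumr.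
Qed.

(** * Placements versus distinct rearrangements *)

Lemma perm_set_nth (u w : seq nat) i x : (i < size u)%N ->
  perm_eq (set_nth 0%N u i x) (x :: w) = perm_eq u (nth 0%N u i :: w).
Proof.
move=> lt_i; rewrite -[X in _ = perm_eq X _](cat_take_drop i) (drop_nth 0%N lt_i).
rewrite set_nthE lt_i; set v := take i u; set v' := drop i.+1 u.
have perm_mid y : perm_eql (v ++ y :: v') (y :: v ++ v').
  by apply/permPl; rewrite perm_catC /= perm_cons perm_catC.
by rewrite !perm_mid !perm_cons.
Qed.

Lemma set_nth_restore (u : seq nat) i x : (i < size u)%N ->
  set_nth 0%N (set_nth 0%N u i x) i (nth 0%N u i) = u.
Proof.
move=> lt_i; apply: (@eq_from_nth _ 0%N) => [|j _].
  by rewrite !size_set_nth !(maxn_idPr lt_i).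
rewrite nth_set_nth /=; case: eqVneq => [->|/negPf ji] //.
by rewrite nth_set_nth /= ji.
Qed.

Lemma perm_pad k s x : (size s < k)%N -> {w | perm_eq (pad k s) (0%N :: w) &
  perm_eq (pad k (rcons s x)) (x :: w)}.
Proof.
move=> lt_s; exists (s ++ nseq (k - (size s).+1) 0%N).
  by rewrite /pad -(subnSK lt_s) perm_catC /= perm_cons perm_catC.
by rewrite /pad size_rcons -cat_cons perm_cat2r perm_rcons.
Qed.

Lemma size_pad k s : (size s <= k)%N -> size (pad k s) = k.
Proof. by move=> le_s; rewrite size_cat size_nseq subnKC. Qed.

(** Writing [x] over the zero at position [i] is a bijection of the index sets; writing 0 back
    inverts it. *)
Lemma sum_permutations_rcons k s x (F : seq nat -> rat) i :
    (size s < k)%N -> (i < k)%N ->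
  \sum_(u <- permutations (pad k s) | nth 0%N u i == 0%N) F (set_nth 0%N u i x) =
  \sum_(v <- permutations (pad k (rcons s x)) | nth 0%N v i == x) F v.
Proof.
move=> lt_s lt_i; have [w perm_s perm_sx] := perm_pad x lt_s.
have size_s u : perm_eq u (pad k s) -> (i < size u)%N.
  by move=> /perm_size ->; rewrite size_pad // ltnW.
rewrite -big_filter -[RHS]big_filter -(big_map (fun u => set_nth 0%N u i x) predT F).
apply: perm_big; apply: uniq_perm.
- rewrite map_inj_in_uniq ?filter_uniq ?permutations_uniq // => u v.
  rewrite !mem_filter !mem_permutations.
  move=> /andP[/eqP u0 /size_s lt_u] /andP[/eqP v0 /size_s lt_v] eq_uv.
  by rewrite -(set_nth_restore x lt_u) -(set_nth_restore x lt_v) eq_uv u0 v0.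
- by rewrite filter_uniq ?permutations_uniq.
move=> v; rewrite mem_filter mem_permutations; apply/mapP/andP.
  case=> u; rewrite mem_filter mem_permutations => /andP[/eqP u0 perm_u] ->.
  rewrite nth_set_nth /= eqxx (permPr perm_sx) perm_set_nth ?size_s //.
  by rewrite u0 -(permPr perm_s).
case=> /eqP vi perm_v; have lt_v : (i < size v)%N.
  by rewrite (perm_size perm_v) size_pad ?size_rcons.
exists (set_nth 0%N v i 0%N).
  rewrite mem_filter mem_permutations nth_set_nth /= eqxx (permPr perm_s).
  by rewrite perm_set_nth // vi -(permPr perm_sx).
by rewrite -vi set_nth_restore.
Qed.

Lemma aug_permutations s : all (ltn 0) s ->
  exists2 c : rat, c != 0 & forall k (F : seq nat -> rat), (size s <= k)%N ->
    aug k s (fun a => F (mkseq a k)) (fun=> 0%N) =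
    c * \sum_(u <- permutations (pad k s)) F u.
Proof.
elim/last_ind: s => [_|s x IH].
  exists 1 => [|k F _]; first exact: oner_neq0.
  have -> : permutations (pad k [::]) = [:: nseq k 0%N].
    apply: perm_small_eq => //.
    apply: uniq_perm; rewrite ?permutations_uniq // => u.
    rewrite mem_permutations inE /pad /= subn0.
    apply/idP/eqP => [perm_u|->] //.
    rewrite -[k](size_nseq k 0%N) -(perm_size perm_u); apply/all_pred1P.
    by rewrite (perm_all _ perm_u) all_nseq /= eqxx orbT.
  rewrite big_seq1 mul1r /=; congr F.
  by apply: (@eq_from_nth _ 0%N); rewrite size_mkseq ?size_nseq // => i ik;
    rewrite nth_mkseq // nth_nseq ik.
rewrite all_rcons => /andP[x0 s0]; have [c c0 augE] := IH s0.
(* Each rearrangement arises once for each position that may have received [x] last; since [x] is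
   positive, padding zeros do not count and the factor is independent of [k]. *)
exists (c * (count_mem x s).+1%:R) => [|k F].
  by rewrite mulf_neq0 ?pnatr_eq0.
rewrite size_rcons => lt_s; rewrite aug_rcons.
pose F' u := \sum_(i < k | nth 0%N u i == 0%N) F (set_nth 0%N u i x).
transitivity (aug k s (fun a => F' (mkseq a k)) (fun=> 0%N)).
  apply: eq_aug => a _ _ _; apply: eq_big => [i|i /eqP ai0].
    by rewrite nth_mkseq.
  congr F; apply: (@eq_from_nth _ 0%N).
    by rewrite size_set_nth !size_mkseq; apply/esym/maxn_idPr.
  move=> j; rewrite size_mkseq => jk; rewrite nth_mkseq // nth_set_nth /=.
  case: eqP => [->|/eqP ji]; first by rewrite incr_same ai0.
  by rewrite incr_other // nth_mkseq.
rewrite augE; last exact: ltnW.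
rewrite -mulrA; congr (_ * _); rewrite (exchange_big_dep predT) //=.
under eq_bigr => i _ do rewrite sum_permutations_rcons //.
rewrite (exchange_big_dep predT) //= mulr_sumr.
apply: eq_big_seq => v; rewrite mem_permutations => perm_v.
have size_v : size v = k by rewrite (perm_size perm_v) size_pad ?size_rcons.
rewrite sumr_const mulr_natl; congr (_ *+ _).
transitivity (count_mem x v).
  rewrite -[v in RHS](mkseq_nth 0%N) size_v count_map -sum1_count.
  by rewrite -[k in iota 0 k]subn0 -/(index_iota 0 k) big_mkord -sum1_card.
rewrite (permP perm_v) /pad count_cat count_nseq -cats1 count_cat /= eqxx.
by rewrite eq_sym (gtn_eqF x0) mul0n !addn0 addn1.
Qed.

Theorem theorem2 (alpha beta : seq nat) :
  is_partition alpha -> is_partition beta ->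
  exists P : {poly rat},
    (size P <= (2 * (psize alpha + psize beta)).+1)%N /\
    forall k : nat, (size alpha <= k)%N -> (size beta <= k)%N ->
      Nk k alpha beta = P.[k%:R].
Proof.
have gt0 s : is_partition s -> all (ltn 0) s.
  case/andP=> _; elim: s => //= x s IH.
  by rewrite inE negb_or lt0n eq_sym => /andP[-> /IH].
move=> /gt0 alpha0 /gt0 beta0.
have [c c0 cE] := aug_permutations alpha0.
have [d d0 dE] := aug_permutations beta0.
have [P sP PE] := poly_fun_augdet alpha0 beta0.
exists ((c * d)^-1 *: P); split; first exact: leq_trans (size_scale_leq _ _) sP.
move=> k ka kb; rewrite hornerZ -PE mulrCA; congr (_ * _).
apply: (canRL (mulKf _)); first by rewrite mulf_neq0.
(* [revdet] numbers rows from the bottom, so tuples are reversed; the set of rearrangements is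
   stable under this. *)
pose F u v := Mtilde k (rev u) (rev v).
have sum_rev s (H : seq nat -> rat) : \sum_(u <- permutations s) H u =
    \sum_(u <- permutations s) H (rev u).
  rewrite -(big_map rev predT H); apply: perm_big.
  apply: uniq_perm; rewrite ?(map_inj_uniq (inv_inj revK)) ?permutations_uniq // => u.
  by rewrite -[u in RHS]revK (mem_map (inv_inj revK)) !mem_permutations perm_rev.
rewrite sum_rev; under eq_bigr do rewrite sum_rev.
rewrite -mulrA mulr_sumr.
rewrite -(cE k (fun u => d * \sum_(v <- permutations (pad k beta)) F u v)) //.
apply: eq_aug => a _ _ _; rewrite -dE //; apply: eq_aug => b _ _ _.
rewrite /F Mtilde_Mdet ?size_rev ?size_mkseq //.
by apply: eq_Mdet => i ik; rewrite nth_rev size_mkseq // nth_mkseq // ; lia.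
Qed.
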